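(* For relatively prime nonzero integers $a,b$ define $\widetilde{\chi}(a/b)=\lambda(b)\,(1-2\lambda(a))$. Let $n$ be a positive integer and let $\mathcal{V}(Z(n))=B_1\times\cdots\times B_s$. Then \[\chi(n)=\widetilde{\chi}(\langle B_1\rangle)\,\widetilde{\chi}(\langle B_2\rangle)\cdots\widetilde{\chi}(\langle B_s\rangle).\]
   Context: Let $f_0=f_1=1$, $f_i=f_{i-1}+f_{i-2}$ ($i\ge2$). A Fibonacci partition of $n$ is a finite set $\{f_{i_1},\dots,f_{i_h}\}$ with $1\le i_1<\dots<i_h$ and sum $n$; $F_h(n)$ is the number with $h$ parts and $\chi(n)=\sum_{h\ge0}(-1)^hF_h(n)$. For an integer $m$, $\lambda(m)=m\bmod2\in\{0,1\}$. A 2-partition is a finite set $\{i_1<\dots<i_q\}$ of positive integers with consecutive differences $\ge2$; $Z(n)=\{\mu_1(n)<\dots<\mu_q(n)\}$ is the unique 2-partition with $n=\sum_a f_{\mu_a(n)}$ (Zeckendorf). The canonical form of a nonempty 2-partition $I$ is its decomposition $I=I_1\cup\dots\cup I_s$ into maximal runs of consecutive elements of equal parity (so all elements of each $I_a$ have the same parity, $\max I_a<\min I_{a+1}$ and $\min I_{a+1}-\max I_a$ is odd). The associated vector of $I=\{i_1<\dots<i_q\}$ is $(\alpha_1,\dots,\alpha_q)$ with $\alpha_1=\lfloor(i_1-1)/2\rfloor+1$, $\alpha_r=\lfloor(i_r-i_{r-1})/2\rfloor+1$ ($r>1$); splitting it into consecutive blocks $B_1,\dots,B_s$ of lengths $|I_1|,\dots,|I_s|$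 gives the associated multivector $\mathcal{V}(I)=B_1\times\cdots\times B_s$. With $\phi_\alpha(t)=t+\dots+t^\alpha$, let $D(\emptyset;t)=1$, $D(\alpha_1;t)=\phi_{\alpha_1}(t)$, $D(\alpha_1,\dots,\alpha_r;t)=\phi_{\alpha_r}(t)D(\alpha_1,\dots,\alpha_{r-1};t)-t^{\alpha_r+1}D(\alpha_1,\dots,\alpha_{r-2};t)$, and $D(A)=D(A;1)$. For $B=(\beta_1,\dots,\beta_q)$ put $\langle B\rangle=D(\beta_2,\dots,\beta_q)/D(\beta_1,\dots,\beta_q)$, regarded as a fraction in lowest terms (numerator and denominator are coprime positive integers). *)

(* Defs.v *)
From HB Require Import structures.
From mathcomp Require Import all_boot all_order all_algebra.
From mathcomp Require Import zify.
Set Implicit Arguments.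
Unset Strict Implicit.
Unset Printing Implicit Defensive.
Import Order.TTheory GRing.Theory Num.Theory.

Fixpoint fib (i : nat) : nat :=
  match i with
  | 0 => 1
  | i'.+1 => match i' with 0 => 1 | i''.+1 => fib i' + fib i'' end
  end.

Arguments fib : simpl never.

Lemma fibSS i : fib i.+2 = fib i.+1 + fib i. Proof. by []. Qed.

Lemma fib_gt0 i : 0 < fib i.
Proof.
suff: (0 < fib i) && (0 < fib i.+1) by case/andP.
by elim: i => // i /andP[h1 h2]; rewrite h2 fibSS addn_gt0 h2.
Qed.

Lemma leq_fib i : i <= fib i.
Proof.
case: i => // i; elim: i => // i IH; rewrite fibSS.
by have := fib_gt0 i; lia.
Qed.

(* The indices may be bounded by x because i <= fib i. *)
Definition is_fib_part (x : nat) : bool := x \in [seq fib i | i <- iota 1 x].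

Lemma is_fib_partP x : reflect (exists2 i, 0 < i & x = fib i) (is_fib_part x).
Proof.
apply: (iffP mapP) => [[i]|[i i_gt0 ->]].
  by rewrite mem_iota => /andP[i_gt0 _] ->; exists i.
by exists i => //; rewrite mem_iota i_gt0 add1n ltnS leq_fib.
Qed.

(* A Fibonacci partition is the set of its parts; no part exceeds the sum n,
   so every Fibonacci partition of n is a subset of 'I_n.+1. *)
Definition fib_partition (n : nat) (P : {set 'I_n.+1}) : bool :=
  [forall x in P, is_fib_part x] && (\sum_(x in P) (x : nat) == n).

Definition num_fib_partitions (h n : nat) : nat :=
  #|[set P : {set 'I_n.+1} | fib_partition P & #|P| == h]|.

(* The terms with h > n + 1 vanish. *)
Definition chi (n : nat) : int :=
  (\sum_(h < n.+2) (-1) ^+ h * (num_fib_partitions h n)%:R)%R.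

(* A 2-partition is represented by its increasing list of elements. *)
Definition two_partition (I : seq nat) : bool :=
  all (fun i => 0 < i) I && sorted (fun i j => i.+2 <= j) I.

Definition is_zeckendorf (n : nat) (I : seq nat) : bool :=
  two_partition I && (\sum_(i <- I) fib i == n).

Lemma two_partition_rcons I k :
  two_partition (rcons I k) =
  [&& 0 < k, two_partition I & all (fun i => i.+2 <= k) I].
Proof.
rewrite /two_partition all_rcons -!andbA; congr (_ && (_ && _)).
have tr : transitive (fun i j => i.+2 <= j) by move=> j i l; lia.
by rewrite !(sorted_pairwise tr) pairwise_rcons andbC.
Qed.

Lemma zeckendorf_bounded k n : n < fib k.+1 ->
  exists2 I, is_zeckendorf n I & all (fun i => i <= k) I.
Proof.
elim/ltn_ind: k n => -[|k] IH n lt_n.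
  by exists [::] => //; rewrite /is_zeckendorf big_nil eq_sym -leqn0.
have [lt_nk|le_kn] := ltnP n (fib k.+1).
  have [I zI leI] := IH k (ltnSn _) _ lt_nk; exists I => //.
  by apply: sub_all leI => i; lia.
have ltd : n - fib k.+1 < fib k by rewrite ltn_subLR.
have [I /andP[tI /eqP sI] leI] : exists2 I, is_zeckendorf (n - fib k.+1) I &
    all (fun i => i <= k.-1) I.
  case: k IH {lt_n le_kn} ltd => [|k] IH ltd; last exact: IH (leqW (leqnn _)) _ ltd.
  by exists [::] => //; rewrite /is_zeckendorf big_nil eq_sym -leqn0.
exists (rcons I k.+1).
  rewrite /is_zeckendorf two_partition_rcons tI big_rcons /= sI.
  apply/andP; split; last by apply/eqP; lia.
  apply/allP => i iI; move/allP/(_ i iI): leI => lei.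
  by have /andP[/allP/(_ i iI)] := tI; lia.
rewrite all_rcons leqnn /=; apply: sub_all leI => i; lia.
Qed.

Lemma zeckendorf_exists n : exists I, is_zeckendorf n I.
Proof. by have [I zI _] := zeckendorf_bounded (leq_fib n.+1); exists I. Qed.

Lemma zeckendorf_lt I k :
  two_partition I -> all (fun i => i <= k) I -> \sum_(i <- I) fib i < fib k.+1.
Proof.
elim/last_ind: I k => [|I j IH] k; first by rewrite big_nil fib_gt0.
rewrite two_partition_rcons all_rcons big_rcons => /and3P[j0 tI ltI] /andP[jk _].
have fib_mono a b : a <= b -> fib a <= fib b.
  move/subnK <-; elim: (b - a) => // d; rewrite addSn => h.
  apply: leq_trans h _; case: (d + a) => // e; rewrite fibSS; exact: leq_addr.
apply: leq_trans (fib_mono j.+1 k.+1 jk).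
case: j j0 ltI {jk} => // -[_|j _] ltI.
  by case: I ltI {IH tI} => [|i I] /=; rewrite ?big_nil.
rewrite [fib j.+3]fibSS; have h := IH j tI.
have {h} : \sum_(i <- I) fib i < fib j.+1.
  by apply: h; apply: sub_all ltI => i; lia.
by rewrite /=; lia.
Qed.

Lemma zeckendorf_unique n I J : is_zeckendorf n I -> is_zeckendorf n J -> I = J.
Proof.
elim/last_ind: I J n => [|I i IH] J n.
  case/andP=> _; rewrite big_nil => /eqP <- /andP[_].
  case: J => // j J; rewrite big_cons => /eqP h.
  by have := fib_gt0 j; lia.
case/lastP: J => [|J j].
  move=> /andP[_ /eqP <-] /andP[_]; rewrite big_nil big_rcons => /eqP h.
  by have := fib_gt0 i; move: h => /=; lia.
have aux K k l : two_partition (rcons K k) -> k < l -> 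
    \sum_(a <- rcons K k) fib a < fib l.
  case: l => // l tK lt_kl; apply: zeckendorf_lt => //.
  move: tK; rewrite two_partition_rcons all_rcons => /and3P[_ _ h].
  by rewrite -ltnS lt_kl; apply: sub_all h => a; lia.
move=> /andP[tI /eqP sI] /andP[tJ /eqP sJ].
have aux2 K k : fib k <= \sum_(a <- rcons K k) fib a.
  by rewrite big_rcons /= leq_addl.
have eij : i = j.
  case: (ltngtP i j) => // lt.
    by have := aux _ _ _ tI lt; have := aux2 J j; rewrite sI sJ; lia.
  by have := aux _ _ _ tJ lt; have := aux2 I i; rewrite sI sJ; lia.
move: tI tJ sI sJ; rewrite -{j}eij !two_partition_rcons !big_rcons /=.
move=> /and3P[_ tI _] /and3P[_ tJ _] sI sJ; congr (rcons _ _).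
by apply: (IH J (n - fib i)); rewrite /is_zeckendorf ?tI ?tJ; apply/eqP; lia.
Qed.

Definition Z (n : nat) : seq nat := xchoose (zeckendorf_exists n).

Lemma ZP n : is_zeckendorf n (Z n).
Proof. exact: xchooseP. Qed.

Fixpoint canonical_form (I : seq nat) : seq (seq nat) :=
  match I with
  | [::] => [::]
  | i :: I' =>
      match canonical_form I' with
      | (j :: r) :: rs =>
          if odd i == odd j then (i :: j :: r) :: rs else [:: i] :: (j :: r) :: rs
      | _ => [:: [:: i]]
      end
  end.

(* Both lemmas together characterize the decomposition into maximal runs of
   equal parity. *)
Lemma canonical_form_flatten I :
  flatten (canonical_form I) = I /\ [::] \notin canonical_form I.
Proof.
elim: I => //= i I [].
case: (canonical_form I) => [|[|j r] rs] //= <-; first by [].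
by rewrite in_cons /= => nrs; case: ifP => _; rewrite !in_cons /= nrs.
Qed.

Lemma canonical_form_parity I :
  all (fun r => constant [seq odd i | i <- r]) (canonical_form I) /\
  sorted (fun r r' => odd (last 0 r) != odd (head 0 r')) (canonical_form I).
Proof.
elim: I => //= i I [].
case: (canonical_form I) => [|[|j r] rs] //= /andP[cj crs] srs.
case: ifP => [/eqP eij|neij] /=; last by rewrite cj crs neij srs.
by rewrite eij eqxx cj crs; split=> //; case: rs srs {crs}.
Qed.

Definition assoc_vector (I : seq nat) : seq nat :=
  match I with
  | [::] => [::]
  | i1 :: I' => ((i1 - 1) %/ 2).+1 :: pairmap (fun i j => ((j - i) %/ 2).+1) i1 I'
  end.

Definition multivector (I : seq nat) : seq (seq nat) :=
  reshape (shape (canonical_form I)) (assoc_vector I).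

Local Open Scope ring_scope.

Definition phi (a : nat) : {poly int} := \sum_(1 <= k < a.+1) 'X^k.

(* The recursion peels off the last entry, so it runs on the reversed vector:
   [Drev [:: alpha_r; ..; alpha_1]] is D(alpha_1, .., alpha_r; t). *)
Fixpoint Drev (s : seq nat) : {poly int} :=
  match s with
  | [::] => 1
  | a :: s' =>
      match s' with
      | [::] => phi a
      | _ :: s'' => phi a * Drev s' - 'X^(a.+1) * Drev s''
      end
  end.

Definition Dpoly (A : seq nat) : {poly int} := Drev (rev A).

Definition Dval (A : seq nat) : int := (Dpoly A).[1].

Definition bracket (B : seq nat) : rat := (Dval (behead B))%:~R / (Dval B)%:~R.

Definition lambda (m : int) : int := (m %% 2)%Z.

(* [numq x] and [denq x] are the coprime numerator and denominator of x. *)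
Definition chi_tilde (x : rat) : int :=
  lambda (denq x) * (1 - 2 * lambda (numq x)).

(* Main.v *)
(** Up to the bound on the parts, chi n is the coefficient of X^n in the product
    of the 1 - X^(f_i).  Multiplying out the factors one at a time, and using
    that f_1 + ... + f_m < f_(m+2), expresses chi (f_k + f_j + n) through
    chi (f_j + n) and chi n, where f_k and f_j are the two largest Zeckendorf
    parts: if k - j is even this is the recursion defining D at t = -1, and if
    k - j is odd the coefficient of chi n vanishes.  Hence chi n is the product
    of the values D(B; -1) over the blocks B.

    Since D(.; 1) and D(.; -1) agree modulo 2, it remains to recover the sign of
    D(B; -1) from parities.  The pair (D(beta_1, ..., beta_r; -1),
    D(beta_2, ..., beta_r; -1)) stays in one of the two triples
    {(1,0), (-1,s), (0,-s)}, s = 1 or -1, in which the first entry is 1 exactly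
    when it is odd and the second one is even.  At t = 1 the same recursion has
    determinant 1, so the quotient <B> is already in lowest terms. *)
Require Import Defs.
From HB Require Import structures.
From mathcomp Require Import all_boot all_order all_algebra.
From mathcomp Require Import zify ring.
Set Implicit Arguments.
Unset Strict Implicit.
Unset Printing Implicit Defensive.
Import Order.TTheory GRing.Theory Num.Theory.
Local Open Scope ring_scope.

(** * Coefficients of the truncated Fibonacci product *)

Definition fib_coef (m n : nat) : int :=
  (\prod_(1 <= i < m.+1) (1 - 'X^(fib i)) : {poly int})`_n.

Lemma leq_fib2 i j : (i <= j)%N -> (fib i <= fib j)%N.
Proof.
move/subnK <-; elim: (j - i)%N => // d IH; rewrite addSn.
by apply: leq_trans IH _; case: (d + i)%N => // e; rewrite fibSS leq_addr.
Qed.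

Lemma fib_inj i j : (0 < i)%N -> (0 < j)%N -> fib i = fib j -> i = j.
Proof.
have lt a b : (0 < a)%N -> (a < b)%N -> (fib a < fib b)%N.
  case: a => // a _ lt_ab; apply: leq_trans (leq_fib2 lt_ab).
  by rewrite fibSS; have := fib_gt0 a; lia.
by move=> i0 j0 e; case: (ltngtP i j) => // /lt; rewrite e ltnn => h; [have := h i0|have := h j0].
Qed.

Lemma fib_coef0 n : fib_coef 0 n = (n == 0%N)%:R.
Proof. by rewrite /fib_coef big_geq // coef1. Qed.

Lemma fib_coefS m n : fib_coef m.+1 n =
  fib_coef m n - (if (n < fib m.+1)%N then 0 else fib_coef m (n - fib m.+1)).
Proof. by rewrite /fib_coef big_nat_recr //= mulrBr mulr1 coefB coefMXn. Qed.

Lemma fib_coefS_lt m n : (n < fib m.+1)%N -> fib_coef m.+1 n = fib_coef m n.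
Proof. by move=> lt_n; rewrite fib_coefS lt_n subr0. Qed.

Lemma fib_coefS_ge m n :
  fib_coef m.+1 (fib m.+1 + n) = fib_coef m (fib m.+1 + n) - fib_coef m n.
Proof. by rewrite fib_coefS ltnNge leq_addr addKn. Qed.

(* The parts f_1, ..., f_m add up to f_(m+2) - 2. *)
Lemma fib_coef_large m n : (fib m.+2 <= n.+1)%N -> fib_coef m n = 0.
Proof.
elim: m n => [|m IH] n; first by rewrite fib_coef0; case: n.
rewrite fibSS => le_n; rewrite fib_coefS !IH ?if_same ?subrr //.
  by have := fib_gt0 m.+1; lia.
by lia.
Qed.

Lemma fib_coef_stable m m' n :
  (n < fib m.+1)%N -> (m <= m')%N -> fib_coef m' n = fib_coef m n.
Proof.
move=> lt_n /subnK <-; elim: (m' - m)%N => // d IH.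
rewrite addSn fib_coefS_lt //.
by apply: leq_trans lt_n (leq_fib2 _); lia.
Qed.

Lemma chi_signed_sum n :
  chi n = \sum_(P : {set 'I_n.+1} | fib_partition P) (-1) ^+ #|P|.
Proof.
have card_lt (P : {set 'I_n.+1}) : (#|P| < n.+2)%N.
  by have := max_card (mem P); rewrite card_ord ltnS.
rewrite (partition_big (fun P : {set _} => Ordinal (card_lt P)) xpredT) //=.
apply: eq_bigr => h _; rewrite /num_fib_partitions.
rewrite (eq_bigr (fun=> (-1) ^+ h)) => [|P /andP[_ /eqP <-]] //.
rewrite sumr_const mulr_natr; congr (_ *+ _).
by apply: eq_card => P; rewrite !inE.
Qed.

(** Expanding the product over subsets, a set [P] of parts contributes its sign at the exponent
    given by its sum. *)
Lemma chi_coef_prod n :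
  chi n =
  (\prod_(0 <= x < n.+1 | is_fib_part x) (1 - 'X^x) : {poly int})`_n.
Proof.
rewrite big_mkord big_mkcond /=.
rewrite (eq_bigr (fun x : 'I_n.+1 =>
  (if is_fib_part x then - 'X^x else 0) + 1 : {poly int})); last first.
  by move=> x _; case: ifP; rewrite ?add0r // addrC.
rewrite bigA_distr coef_sum chi_signed_sum big_mkcond /=.
apply: eq_bigr => P _; rewrite -big_mkcond /= /fib_partition.
have [/forall_inP fibP|nfibP] := boolP [forall x in P, is_fib_part x] => /=.
  rewrite (eq_bigr (fun x : 'I_n.+1 => - 'X^x)) => [|x /fibP -> //].
  rewrite prodrN prodrXr -(rmorph1 polyC) -rmorphN -rmorphXn /=.
  rewrite coefCM coefXn eq_sym.
  by case: eqP; rewrite ?mulr1 ?mulr0.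
have [x xP nx] := forall_inPn nfibP.
by rewrite (bigD1 x) //= (negPf nx) mul0r coef0.
Qed.

Lemma chi_fib_coef m n : (n < fib m.+1)%N -> chi n = fib_coef m n.
Proof.
move=> lt_n.
have lt_n' : (n < fib n.+1)%N by exact: leq_trans (leq_fib _).
suff -> : chi n = fib_coef n n.
  case: (leqP m n) => [le_mn|/ltnW le_nm]; first exact: fib_coef_stable.
  by rewrite (fib_coef_stable lt_n').
rewrite chi_coef_prod -big_filter.
rewrite (perm_big [seq fib i | i <- index_iota 1 n.+1 & (fib i <= n)%N]);
  last first.
  apply: uniq_perm; first by rewrite filter_uniq // iota_uniq.
    rewrite map_inj_in_uniq ?filter_uniq ?iota_uniq // => i j.
    rewrite !mem_filter !mem_index_iota => /and3P[_ i0 _] /and3P[_ j0 _].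
    exact: fib_inj.
  move=> x; rewrite mem_filter mem_index_iota /= ltnS.
  apply/andP/mapP => [[/is_fib_partP[i i0 ->] le_n]|[i]].
    exists i => //; rewrite mem_filter le_n mem_index_iota i0 ltnS.
    exact: leq_trans (leq_fib _) le_n.
  rewrite mem_filter mem_index_iota => /and3P[le_n i0 _] ->; split=> //.
  by apply/is_fib_partP; exists i.
rewrite big_map big_filter.
(* The exponent must vary over all [j <= n], since each factor shifts it down. *)
suff H m' j : (j <= n)%N ->
    (\prod_(1 <= i < m'.+1 | (fib i <= n)%N) (1 - 'X^(fib i)) : {poly int})`_j
    = fib_coef m' j by exact: H.
elim: m' j => [|k IH] j le_jn; first by rewrite /fib_coef !big_geq.
rewrite big_mkcond big_nat_recr //= -big_mkcond /=.
case: leqP => [le_k|lt_k].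
  rewrite mulrBr mulr1 coefB coefMXn fib_coefS !IH //.
  exact: leq_trans (leq_subr _ _) le_jn.
by rewrite mulr1 IH // fib_coefS_lt //; lia.
Qed.

(* [fib_coef k (fib k + n)] is chi (f_k + n) when n < f_(k-1), but the
   recursion needs it for larger n as well. *)
Lemma fib_coef_step2 k n :
  fib_coef k.+2 (fib k.+2 + n) = - fib_coef k.+1 n - fib_coef k (fib k + n).
Proof.
have e : (fib k.+2 + n = fib k.+1 + (fib k + n))%N by rewrite fibSS addnA.
(* Without [fib k.+2] and [fib k.+1] the remaining parts are too small to reach the sum. *)
rewrite fib_coefS_ge {1}e fib_coefS_ge -e fib_coef_large; last by lia.
by rewrite sub0r addrC.
Qed.

(** Each double step sends c to [- chi n] - c, so the copies of [chi n] cancel in pairs. *)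
Lemma fib_coef_iter k n m : (n < fib k.+2)%N ->
  fib_coef (k + m.*2) (fib (k + m.*2) + n) =
  - (odd m)%:R * chi n + (-1) ^+ m * fib_coef k (fib k + n).
Proof.
move=> lt_n; elim: m => [|m IH]; first by rewrite addn0 /=; ring.
rewrite doubleS !addnS fib_coef_step2 IH -(@chi_fib_coef (k + m.*2).+1); last first.
  by apply: leq_trans lt_n (leq_fib2 _); lia.
by rewrite exprS /=; case: (odd m) => /=; ring.
Qed.

Lemma chi_fib k : (0 < k)%N -> chi (fib k) = - (odd (k.-1 %/ 2).+1)%:R.
Proof.
move=> k0; have chi0 : chi 0 = 1 by rewrite (@chi_fib_coef 0) // fib_coef0.
rewrite -[fib k]addn0 (@chi_fib_coef k); last first.
  case: k k0 => // k _; rewrite fibSS addn0.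
  by have := fib_gt0 k; lia.
have := odd_double_half k; have [ok|ek] := boolP (odd k) => ek2.
  have -> : (k.-1 %/ 2 = k./2)%N by lia.
  have {1 2}-> : k = (1 + k./2.*2)%N by lia.
  rewrite fib_coef_iter // chi0 fib_coefS_ge !fib_coef0 /= -signr_odd.
  by case: (odd k./2).
have -> : ((k.-1 %/ 2).+1 = k./2)%N by lia.
(* For even [k] the descent ends at index 0, where the empty product has no term of degree [fib 0] =
   1. *)
have {1 2}-> : k = (0 + k./2.*2)%N by lia.
by rewrite fib_coef_iter // chi0 fib_coef0 /= mulr1 mulr0 addr0.
Qed.

Lemma chi_add_fib j k n : (j.+2 <= k)%N -> (n < fib j.+1)%N ->
  chi (fib k + n) = fib_coef k (fib k + n).
Proof.
case: k => // k le_jk lt_n; apply: chi_fib_coef; rewrite fibSS ltn_add2l.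
by apply: leq_trans lt_n (leq_fib2 _).
Qed.

(** The descent from [k] ends at [j.+1]; omitting [fib j.+1] there leaves parts too small, so only a
    multiple of [chi n] survives. *)
Lemma chi_add_fib_odd j k n : (j.+2 <= k)%N -> odd (k - j) ->
  (fib j <= n < fib j.+1)%N ->
  chi (fib k + n) = - (odd ((k - j) %/ 2).+1)%:R * chi n.
Proof.
move=> le_jk odd_kj /andP[le_n lt_n].
rewrite (chi_add_fib le_jk lt_n); set m := ((k - j) %/ 2)%N.
have -> : k = (j.+1 + m.*2)%N by lia.
rewrite fib_coef_iter; last by apply: leq_trans lt_n (leq_fib2 _); lia.
rewrite fib_coefS_ge fib_coef_large; last by rewrite fibSS; lia.
by rewrite (chi_fib_coef lt_n) -signr_odd /=; case: (odd m) => /=; ring.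
Qed.

(** Here the descent ends at [j] itself, with value [- (chi (fib j + n) + chi n)]. *)
Lemma chi_add_fib_even j k n :
  (0 < j)%N -> (j.+2 <= k)%N -> ~~ odd (k - j) -> (n < fib j.-1)%N ->
  chi (fib k + (fib j + n)) =
  - (odd ((k - j) %/ 2).+1)%:R * chi (fib j + n) +
  (-1) ^+ ((k - j) %/ 2).+1 * chi n.
Proof.
move=> j0 le_jk even_kj lt_n.
have ek : k = (j + ((k - j) %/ 2).*2)%N by lia.
have : (0 < (k - j) %/ 2)%N by lia.
move: ((k - j) %/ 2)%N ek {le_jk even_kj} => m -> m0.
case: j j0 lt_n => //= j _ lt_n.
have lt_jn : (fib j.+1 + n < fib j.+2)%N by rewrite fibSS ltn_add2l.
rewrite (@chi_add_fib j.+1) //; last by lia.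
rewrite fib_coef_iter; last by apply: leq_trans lt_jn (leq_fib2 _).
rewrite fib_coefS_ge fib_coef_large; last by rewrite fibSS; have := leq_fib2 (leqnSn j); lia.
have := fib_coefS_ge j n.
rewrite -(chi_fib_coef lt_jn) -(@chi_fib_coef j n); last first.
  exact: leq_trans lt_n (leq_fib2 _).
move=> e; have -> : fib_coef j (fib j.+1 + n) = chi (fib j.+1 + n) + chi n.
  by rewrite e subrK.
by rewrite exprS -signr_odd /=; case: (odd m) => /=; ring.
Qed.

(** * Values of D at 1 and -1 *)

Lemma phi_eval1 a : (phi a).[1] = a%:R.
Proof.
rewrite /phi horner_sum (eq_bigr (fun=> 1)) => [|i _].
  by rewrite sumr_const_nat subn1.
by rewrite hornerXn expr1n.
Qed.

Lemma phi_evalN1 a : (phi a).[-1] = - (odd a)%:R.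
Proof.
elim: a => [|a IH]; first by rewrite /phi big_geq // horner0 oppr0.
rewrite /phi big_nat_recr //= hornerD IH hornerXn -signr_odd /=.
by case: (odd a).
Qed.

Lemma Dpoly_rcons2 A b a :
  Dpoly (rcons (rcons A b) a) =
  phi a * Dpoly (rcons A b) - 'X^(a.+1) * Dpoly A.
Proof. by rewrite /Dpoly !rev_rcons. Qed.

Lemma Dpoly1 a : Dpoly [:: a] = phi a.
Proof. by []. Qed.

(* The last two convergents satisfy one linear recursion; the virtual value
   0 for D(beta_2, ..., beta_0) makes it start at (1, 0). *)
Lemma continuant_ind (t : int) (Q : pred nat) (b : nat)
    (Inv : int -> int -> int -> int -> Prop) :
  Inv 1 0 (phi b).[t] 1 ->
  (forall a x' y' x y, Q a -> Inv x' y' x y ->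
     Inv x y ((phi a).[t] * x - t ^+ a.+1 * x')
             ((phi a).[t] * y - t ^+ a.+1 * y')) ->
  forall C, all Q C ->
  exists x' y', Inv x' y' (Dpoly (b :: C)).[t] (Dpoly C).[t].
Proof.
move=> Inv0 InvS C QC.
(* Stating the recursion for every next entry [a] pins down [(x', y')] as the previous pair, virtual
   at the start. *)
suff [x' [y' []]] : exists x' y', Inv x' y' (Dpoly (b :: C)).[t] (Dpoly C).[t] /\
   forall a, (Dpoly (rcons (b :: C) a)).[t] =
               (phi a).[t] * (Dpoly (b :: C)).[t] - t ^+ a.+1 * x' /\
             (Dpoly (rcons C a)).[t] =
               (phi a).[t] * (Dpoly C).[t] - t ^+ a.+1 * y'.
  by exists x', y'.
elim/last_ind: C QC => [_|C c IH].
  exists 1, 0; rewrite Dpoly1 [Dpoly [::]]/(1 : {poly int}) hornerC; split=> // a.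
  rewrite -[[:: b]]/(rcons [::] b) Dpoly_rcons2 /= !Dpoly1.
  by rewrite !(hornerE, hornerXn).
rewrite all_rcons => /andP[Qc QC].
have {IH QC} [x' [y' [inv rec]]] := IH QC.
exists (Dpoly (b :: C)).[t], (Dpoly C).[t]; split.
  by case: (rec c) => -> ->; apply: InvS.
move=> a; rewrite -rcons_cons !Dpoly_rcons2.
by rewrite !(hornerE, hornerXn).
Qed.

(** For [a >= 2], [0 < x' <= x] gives [a * x - x' >= x], so positivity persists; the determinant is
    a Bezout relation. *)
Lemma Dval_coprime_pos b C : (0 < b)%N -> all (leq 2) C ->
  0 < Dval (b :: C) /\ coprimez (Dval C) (Dval (b :: C)).
Proof.
move=> b0 C2.
have [x' [y' [/andP[x'0 x'x] det]]] := @continuant_ind 1 (leq 2) b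
  (fun x' y' x y => (0 < x' <= x) /\ x' * y - x * y' = 1)
  ltac:(rewrite phi_eval1; lia)
  ltac:(move=> a x' y' x y a2 [/andP[x'0 x'x] det];
        rewrite phi_eval1 expr1n !mul1r natz; split; [nia|
        rewrite -det; ring]) C C2.
split; first exact: lt_le_trans x'x.
by apply/coprimezP; exists (x', - y'); rewrite /= -det; ring.
Qed.

(* In each of the two triples {(1,0), (-1,s), (0,-s)} the sum is zero: by
   x_r = -(x_(r-1) + x_(r-2)) an odd entry moves to the third element of
   the triple, while an even one gives back x_(r-2). *)
Lemma continuant_evalN1 b C :
  let x := (Dpoly (b :: C)).[-1] in let y := (Dpoly C).[-1] in
  x = lambda x * (1 - 2 * lambda y).
Proof.
pose S (s x y : int) :=
  (x = 1 /\ y = 0) \/ (x = -1 /\ y = s) \/ (x = 0 /\ y = - s).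
have [] := @continuant_ind (-1) xpredT b
  (* Consecutive pairs must differ for the negated sum to be the third element. *)
  (fun x' y' x y => exists s : int, (s = 1 \/ s = -1) /\
     [/\ S s x' y', S s x y & x' <> x \/ y' <> y]) _ _ C (all_predT C).
(* The pair after (1,0) is (-1,1) or (0,1), which determines [s]. *)
- exists (if odd b then 1 else -1); rewrite phi_evalN1 /S.
  by case: (odd b); split; [lia|split; lia|lia|split; lia].
- move=> a x' y' x y _ [s [s1 [S' S0 ne]]]; exists s; split=> //.
  rewrite phi_evalN1 exprS -signr_odd; split=> //; move: S' S0 ne s1;
    by rewrite /S; case: (odd a) => /=; lia.
move=> x' [y' [s [s1 [_ ]]]]; rewrite /S /lambda => h _.
by case: s1 h => -> [[-> ->]|[[-> ->]|[-> ->]]].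
Qed.

Lemma lambda_eval1 (p : {poly int}) : lambda p.[1] = lambda p.[-1].
Proof.
rewrite /lambda; elim/poly_ind: p => [|p c IH]; first by rewrite !horner0.
rewrite !hornerE mulrN1; move: p.[1] p.[-1] IH => u v; lia.
Qed.

Lemma chi_tilde_bracket b C : (0 < b)%N -> all (leq 2) C ->
  chi_tilde (bracket (b :: C)) = (Dpoly (b :: C)).[-1].
Proof.
move=> b0 C2; have [pos cop] := Dval_coprime_pos b0 C2.
rewrite /chi_tilde /bracket coprimeq_num // coprimeq_den //.
rewrite gt_eqF // gtr0_norm // gtr0_sg // mul1r.
by rewrite /Dval !lambda_eval1 -continuant_evalN1.
Qed.

(** * Blocks under appending a largest index *)

Lemma canonical_form_rcons I i k : exists rs r,
  canonical_form (rcons I i) = rcons rs r /\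
  canonical_form (rcons (rcons I i) k) =
  if odd i == odd k then rcons rs (rcons r k) else rcons (rcons rs r) [:: k].
Proof.
elim: I => [|a I [rs [r [e1 e2]]]].
  by exists [::], [:: i] => /=; case: ifP.
have [_] := canonical_form_flatten (rcons I i).
rewrite !rcons_cons /= e2 e1 {e1 e2}.
case: rs => [|[|d ds] rs]; rewrite ?rcons_cons in_cons //=.
  case: r => [|e r] //= _.
  have [ae|ae] := boolP (odd a == odd e).
    by exists [::], [:: a, e & r]; case: ifP; rewrite /= ae.
  by exists [:: [:: a]], (e :: r); case: ifP; rewrite /= (negPf ae).
move=> _; have [ad|ad] := boolP (odd a == odd d).
  by exists ([:: a, d & ds] :: rs), r; case: ifP; rewrite /= ad.
by exists ([:: a] :: (d :: ds) :: rs), r; case: ifP; rewrite /= (negPf ad).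
Qed.

Lemma assoc_vector_rcons I i k :
  assoc_vector (rcons (rcons I i) k) =
  rcons (assoc_vector (rcons I i)) ((k - i) %/ 2).+1.
Proof.
by case: I => //= a I; rewrite -!cats1 !pairmap_cat /= last_cat.
Qed.

Lemma size_assoc_vector I : size (assoc_vector I) = size I.
Proof. by case: I => //= a I; rewrite size_pairmap. Qed.

Lemma multivector_shape I : shape (multivector I) = shape (canonical_form I).
Proof.
rewrite reshapeKl // size_assoc_vector -size_flatten.
by case: (canonical_form_flatten I) => ->.
Qed.

Lemma multivector_flatten I : flatten (multivector I) = assoc_vector I.
Proof.
rewrite reshapeKr // size_assoc_vector -size_flatten.
by case: (canonical_form_flatten I) => ->.
Qed.

Lemma multivector_unique I M : shape M = shape (canonical_form I) ->
  flatten M = assoc_vector I -> multivector I = M.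
Proof. by rewrite /multivector => <- <-; rewrite flattenK. Qed.

Lemma multivector_rcons I i k Bs B (a := ((k - i) %/ 2).+1) :
  multivector (rcons I i) = rcons Bs B ->
  multivector (rcons (rcons I i) k) =
  if odd i == odd k then rcons Bs (rcons B a) else rcons (rcons Bs B) [:: a].
Proof.
move=> eM; have := multivector_shape (rcons I i).
have := multivector_flatten (rcons I i); rewrite eM flatten_rcons => eF.
have [rs [r [-> ecf]]] := canonical_form_rcons I i k; rewrite /shape !map_rcons => /rcons_inj[esh esz].
apply: multivector_unique.
  by rewrite ecf; case: ifP => _; rewrite /shape !map_rcons /= ?size_rcons esh esz.
rewrite assoc_vector_rcons -eF.
by case: ifP => _; rewrite !flatten_rcons -!cats1 -?catA.
Qed.

(** Gaps of at least 2 give entries at least 2; only the very first entry of the vector can be 1. *)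
Definition good_block (B : seq nat) : bool :=
  if B is b :: C then (0 < b)%N && all (leq 2) C else false.

Lemma good_block_rcons B b a :
  good_block (rcons B b) -> (2 <= a)%N -> good_block (rcons (rcons B b) a).
Proof.
by case: B => [|c B] /=; [case: b => // b _ ->|rewrite !all_rcons => /and3P[-> -> ->] ->].
Qed.

(** The value at [I] is carried along because the recursion inside a block has two terms; [B] is
    empty when [i] opens a block. *)
Lemma chi_multivector I i : two_partition (rcons I i) ->
  exists Bs B b, [/\ multivector (rcons I i) = rcons Bs (rcons B b),
    all good_block (rcons Bs (rcons B b)),
    chi (\sum_(j <- I) fib j)%N =
      \prod_(C <- Bs) (Dpoly C).[-1] * (Dpoly B).[-1] &
    chi (\sum_(j <- rcons I i) fib j)%N =
      \prod_(C <- Bs) (Dpoly C).[-1] * (Dpoly (rcons B b)).[-1]].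
Proof.
elim/last_ind: I i => [|I j IH] k tI.
  exists [::], [::], ((k - 1) %/ 2).+1; split=> //.
  - by rewrite !big_nil hornerC (@chi_fib_coef 0) // fib_coef0.
  - rewrite big_cons !big_nil addn0 mul1r Dpoly1 phi_evalN1 chi_fib ?subn1 //.
    by move: tI; rewrite /two_partition /= andbT => /andP[].
move: tI; rewrite two_partition_rcons => /and3P[k0 tI].
rewrite all_rcons => /andP[le_jk _].
have [Bs [B [b [eM good chiI chiIj]]]] := IH j tI.
have := tI; rewrite two_partition_rcons => /and3P[j0 tI' ltI].
(* The indices in [I] are at most [j - 2]. *)
have lt_j : (\sum_(i <- I) fib i < fib j.-1)%N.
  case: j j0 ltI {IH tI eM le_jk chiIj} => // -[|j] _ ltI.
    by case: I ltI {tI' chiI} => [|? ?] //=; rewrite big_nil.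
  by apply: zeckendorf_lt => //; apply: sub_all ltI => i; lia.
set n := (\sum_(i <- rcons I j) fib i)%N in chiIj *.
have en : n = (fib j + \sum_(i <- I) fib i)%N by rewrite /n big_rcons addnC.
have -> : (\sum_(i <- rcons (rcons I j) k) fib i)%N = (fib k + n)%N.
  by rewrite big_rcons addnC.
have [ejk|njk] := boolP (odd j == odd k).
  exists Bs, (rcons B b), ((k - j) %/ 2).+1; split => //.
  - by rewrite (multivector_rcons _ eM) ejk.
  - move: good; rewrite !all_rcons => /andP[gB ->]; rewrite andbT.
    by apply: good_block_rcons => //; lia.
  rewrite Dpoly_rcons2 en chi_add_fib_even //; last by lia.
  rewrite -en chiIj chiI hornerD hornerN hornerM [('X^_ * _).[_]]hornerM
    hornerXn phi_evalN1.
  rewrite [(-1) ^+ _.+2]exprS; ring.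
exists (rcons Bs (rcons B b)), [::], ((k - j) %/ 2).+1; split => //.
- by rewrite (multivector_rcons _ eM) (negPf njk).
- by rewrite all_rcons good.
- by rewrite big_rcons hornerC mulr1.
rewrite (@chi_add_fib_odd j) //; first last.
- rewrite en leq_addr; case: j j0 lt_j {IH tI eM le_jk ltI njk chiIj en n} => //.
  by move=> j _; rewrite fibSS ltn_add2l.
- by lia.
by rewrite big_rcons Dpoly1 phi_evalN1 chiIj /= mulrC.
Qed.

Theorem theorem2p3 (n : nat) (hn : (0 < n)%N) :
  chi n = \prod_(B <- multivector (Z n)) chi_tilde (bracket B).
Proof.
have /andP[tZ /eqP sZ] := ZP n.
case/lastP: (Z n) tZ sZ => [|I i] tI sI; first by rewrite -sI big_nil in hn.
have [Bs [B [b [eM good _ chiI]]]] := chi_multivector tI.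
rewrite sI in chiI; rewrite chiI eM.
transitivity (\prod_(C <- rcons Bs (rcons B b)) (Dpoly C).[-1]).
  by rewrite big_rcons.
apply: eq_big_seq => -[|c C] /(allP good) //= /andP[c0 C2].
by rewrite chi_tilde_bracket.
Qed.
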